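(* Let $\mathbf{k}$ be a commutative $\mathbb{Q}$-algebra, $\Omega$ a set of operator labels and $Y$ a countably infinite set of variables. For any $\mathbf{k}$-submodule $E \subseteq \mathbf{k}\mathfrak{M}_\Omega(Y)$, an $\Omega$-operated $\mathbf{k}$-algebra is an $E$-algebra if and only if it is a $\mathcal{P}(E)$-algebra, where $\mathcal{P}(E)$ is the polarization of $E$.
   Context: All rings and algebras are associative and unital. An $\Omega$-operated algebra $(A; P_\omega \mid \omega\in\Omega)$ is a (not necessarily commutative) $\mathbf{k}$-algebra $A$ with $\mathbf{k}$-linear maps $P_\omega\colon A\to A$, with no further restriction. Bracket words. Write $M(Z)$ for the free monoid on $Z$. Put $\mathfrak{M}_{\Omega,0}(Y)=M(Y)$ and recursively $\mathfrak{M}_{\Omega,n}(Y)=M\big(Y\uplus\biguplus_{\omega\in\Omega}\lfloor \mathfrak{M}_{\Omega,n-1}(Y)\rfloor_\omega\big)$, where $\lfloor S\rfloor_\omega=\{\lfloor u\rfloor_\omega\mid u\in S\}$ is a disjoint copy of $S$; let $\mathfrak{M}_\Omega(Y)=\bigcup_n \mathfrak{M}_{\Omega,n}(Y)$. Its linear span $\mathbf{k}\mathfrak{M}_\Omega(Y)$, with operators $u\mapsto\lfloor u\rfloor_\omega$, is the free $\Omega$-operated algebra on $Y$. $E$-algebras. For a map $\theta\colon Y\to A$ into an $\Omega$-operated algebra and $l\in\mathbf{k}\mathfrak{M}_\Omega(Y)$, let $l[\theta]\in A$ be the image of $l$ under the unique homomorphism of $\Omega$-operated algebras extending $\theta$.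 For a submodule $E$, $A$ is an $E$-algebra if $l[\theta]=0$ for all $l\in E$ and all $\theta\colon Y\to A$. Polarization. For a word $u\in\mathfrak{M}_\Omega(Y)$, $\deg_y u$ is the number of occurrences of $y$ in $u$; $l$ is homogeneous in $y$ of degree $n$ if all its monomials have degree $n$ in $y$. In that case write $l=\sum_i c_i\,q_i[y,\dots,y]$ with $0\neq c_i\in\mathbf{k}$, where $q_i$ is a bracket word on $(Y\setminus\{y\})\cup\{\star_1,\dots,\star_n\}$ containing each placeholder $\star_j$ exactly once, and $q_i[u_1,\dots,u_n]$ denotes replacing $\star_j$ by $u_j$. Put $\mathcal{P}_y(l)=\sum_{\tau\in S_n}\sum_i c_i\,q_i[y_{\tau(1)},\dots,y_{\tau(n)}]$, where $y_1,\dots,y_n\in Y$ are mutually distinct fresh variables (the choice matters only up to renaming). If $l$ is homogeneous in all its variables, its polarization $\mathcal{P}(l)$ is the result of successively polarizing all variables of $l$. The polarization $\mathcal{P}(E)$ of a submodule $E$ is the submodule of $\mathbf{k}\mathfrak{M}_\Omega(Y)$ spanned by the polarizations of all homogeneous components (components homogeneous in every variable) of elements of $E$. One assumes, renaming variables if necessary, that infinitely many variables of $Y$ do not occur in $E$. *)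

(* Defs.v *)
From HB Require Import structures.
From mathcomp Require Import all_boot all_order all_fingroup all_algebra.
From mathcomp Require Import finmap multiset monalg.
From Stdlib Require IndefiniteDescription.

Set Implicit Arguments.
Unset Strict Implicit.
Unset Printing Implicit Defensive.

Import GRing.Theory.
Local Open Scope ring_scope.

(* algType requires 1 != 0 and so excludes the zero algebra, and the hierarchy
   allows no join of GRing.PzRing and GRing.Lmodule above it. Hence the k-module
   structure is part of the mixin, and is registered as an lmodType below. *)
HB.mixin Record PzRing_isOperatedAlgebra
    (k : comPzRingType) (Omega : Type) A of GRing.PzRing A := {
  oscale : k -> A -> A;
  oscaleA : forall a b v, oscale a (oscale b v) = oscale (a * b) v;
  oscale1 : left_id 1 oscale;
  oscaleDr : right_distributive oscale +%R;
  oscaleDl : forall v, {morph oscale^~ v : a b / a + b};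
  oscaleAl : forall a (u v : A), oscale a (u * v) = oscale a u * v;
  oscaleAr : forall a (u v : A), oscale a (u * v) = u * oscale a v;
  oper : Omega -> A -> A;
  operD : forall w, {morph oper w : u v / u + v};
  operZ : forall w a, {morph oper w : u / oscale a u}
}.

#[short(type="operatedAlgType")]
HB.structure Definition OperatedAlgebra (k : comPzRingType) (Omega : Type) :=
  {A of GRing.PzRing A & PzRing_isOperatedAlgebra k Omega A}.

HB.instance Definition _ (k : comPzRingType) (Omega : Type)
    (A : operatedAlgType k Omega) :=
  GRing.Zmodule_isLmodule.Build k (OperatedAlgebra.sort A)
    (@oscaleA k Omega A) (@oscale1 k Omega A)
    (@oscaleDr k Omega A) (@oscaleDl k Omega A).

Section OperatedAlgebraTheory.
Variables (k : comPzRingType) (Omega : Type) (A : operatedAlgType k Omega).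

Lemma oper_scaleAl (a : k) (u v : A) : a *: (u * v) = (a *: u) * v.
Proof. exact: oscaleAl. Qed.

Lemma oper_scaleAr (a : k) (u v : A) : a *: (u * v) = u * (a *: v).
Proof. exact: oscaleAr. Qed.

Lemma oper_is_linear (w : Omega) : linear (oper w : A -> A).
Proof. by move=> a u v; rewrite operD; congr (_ + _); apply: operZ. Qed.

HB.instance Definition _ (w : Omega) :=
  GRing.isLinear.Build k A A _ (oper w : A -> A) (oper_is_linear w).

End OperatedAlgebraTheory.

Definition operated_morphism (k : comPzRingType) (Omega : Type)
    (A B : operatedAlgType k Omega) (f : A -> B) : Prop :=
  [/\ linear f, {morph f : u v / u * v}, f 1 = 1
    & forall w u, f (oper w u) = oper w (f u)].

Section Submodules.
Variables (k : pzRingType) (V : lmodType k).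

Definition submodule (E : V -> Prop) : Prop :=
  E 0 /\ forall (a : k) (u v : V), E u -> E v -> E (a *: u + v).

Definition span (S : V -> Prop) (v : V) : Prop :=
  forall W : V -> Prop, submodule W -> (forall s, S s -> W s) -> W v.

End Submodules.

Section LinearExtension.
Variables (k : nzRingType) (K : choiceType) (V : lmodType k) (h : K -> V).

Definition linext (g : {malg k[K]}) : V := \sum_(u <- msupp g) g@_u *: h u.

Lemma linextEw (d : {fset K}) g :
  (msupp g `<=` d)%fset -> linext g = \sum_(u <- d) g@_u *: h u.
Proof.
move=> le; rewrite /linext [LHS](big_fset_incl _ le) => //= x xd.
by move/mcoeff_outdom=> ->; rewrite scale0r.
Qed.

Lemma linextP : linear linext.
Proof.
move=> a g1 g2; pose d := (msupp g1 `|` msupp g2)%fset.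
have le1 : (msupp g1 `<=` d)%fset by apply: fsubsetUl.
have le2 : (msupp g2 `<=` d)%fset by apply: fsubsetUr.
have le : (msupp (a *: g1 + g2) `<=` d)%fset.
  apply: fsubset_trans (msuppD_le _ _) _.
  by apply: fsetSU; apply: msuppZ_le.
rewrite (linextEw le) (linextEw le1) (linextEw le2) scaler_sumr -big_split /=.
by apply: eq_bigr => u _; rewrite mcoeffD mcoeffZ scalerDl scalerA.
Qed.

HB.instance Definition _ :=
  GRing.isLinear.Build k {malg k[K]} V _ linext linextP.

Lemma linextU u : linext << u >> = h u.
Proof.
by rewrite (linextEw (d := [fset u]%fset)) ?msuppU_le // big_seq_fset1
  mcoeffUU scale1r.
Qed.

End LinearExtension.

(* Any linear map out of a free module is the linear extension of its
   restriction to the basis. *)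
Lemma linext_unique (k : nzRingType) (K : choiceType) (V : lmodType k)
    (f : {malg k[K]} -> V) :
  linear f -> f =1 linext (fun u => f << u >>).
Proof.
move=> lf g; pose F : {linear _ -> _} := HB.pack f (GRing.isLinear.Build _ _ _ _ f lf).
have -> : f g = F g by [].
rewrite {1}[g]monalgE linear_sum /linext; apply: eq_bigr => u _.
rewrite -[f _]/(F _) -linearZ_LR; congr (F _).
by apply/malgP=> v; rewrite mcoeffZ !mcoeffU mulrnAr mulr1.
Qed.

(* The alphabet Z + { [u]_w }: [Brk w s] is the bracket [s]_w of the word with
   letter sequence [s]. Every element has finite bracket depth, so the union of
   the stages M_n is the free monoid on this alphabet. *)
Inductive letter (Omega Z : Type) : Type :=
| Var of Z
| Brk of Omega & seq (letter Omega Z).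

Section LetterInd.
Variables (Omega Z : Type) (P : letter Omega Z -> Prop)
  (Q : seq (letter Omega Z) -> Prop).
Hypotheses (PV : forall z, P (Var Omega z)) (PB : forall w s, Q s -> P (Brk w s))
  (Q0 : Q [::]) (QS : forall x s, P x -> Q s -> Q (x :: s)).

Fixpoint letter_seq_ind (x : letter Omega Z) : P x :=
  match x with
  | Var z => PV z
  | Brk w s => PB w
      ((fix aux s := match s return Q s with
        | [::] => Q0
        | x :: s' => QS (letter_seq_ind x) (aux s')
        end) s)
  end.

Lemma seq_letter_ind s : Q s.
Proof. by elim: s => // x s; apply/QS/letter_seq_ind. Qed.
End LetterInd.

Section LetterChoice.
Variables (Omega Z : Type).

Fixpoint letter_encode (x : letter Omega Z) : GenTree.tree (Z + Omega) :=
  match x with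
  | Var z => GenTree.Leaf (inl z)
  | Brk w s => GenTree.Node 0 (GenTree.Leaf (inr w) :: map letter_encode s)
  end.

Fixpoint letter_decode (t : GenTree.tree (Z + Omega)) : option (letter Omega Z) :=
  match t with
  | GenTree.Leaf (inl z) => Some (Var Omega z)
  | GenTree.Node _ (GenTree.Leaf (inr w) :: s) =>
      Some (Brk w (pmap letter_decode s))
  | _ => None
  end.

Lemma letter_encodeK : pcancel letter_encode letter_decode.
Proof.
apply: (@letter_seq_ind _ _ _
  (fun s => pmap letter_decode (map letter_encode s) = s)) => //=.
- by move=> w s ->.
- by move=> x s -> /= ->.
Qed.
End LetterChoice.

HB.instance Definition _ (Omega Z : choiceType) :=
  Choice.copy (letter Omega Z) (pcan_type (@letter_encodeK Omega Z)).

Notation bword Omega Z := {fmonom letter Omega Z}.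
Notation bpoly k Omega Z := {malg k[bword Omega Z]}.

Section FreeOperatedAlgebra.
Variables (k : comNzRingType) (Omega Z : choiceType).

Definition bvar (z : Z) : bword Omega Z := FMonom [:: Var Omega z].

Definition bbrk (w : Omega) (u : bword Omega Z) : bword Omega Z :=
  FMonom [:: Brk w u].

Definition bpoly_oper (w : Omega) : bpoly k Omega Z -> bpoly k Omega Z :=
  linext (fun u => << bbrk w u >>).

Fact bpoly_scaleAr (a : k) (u v : bpoly k Omega Z) :
  a *: (u * v) = u * (a *: v).
Proof.
rewrite !malgM_def [in RHS](fgmullw (fsubset_refl _) (msuppZ_le _ _)) fgmull scaler_sumr.
apply: eq_bigr => x _; rewrite scaler_sumr; apply: eq_bigr => y _.
apply/malgP=> z; rewrite [LHS]mcoeffZ mcoeffZ [in LHS]mcoeffU [RHS]mcoeffU.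
by rewrite mulrnAr mulrCA.
Qed.

Fact bpoly_operD w : {morph bpoly_oper w : u v / u + v}.
Proof. exact: linearD. Qed.

Fact bpoly_operZ w a : {morph bpoly_oper w : u / a *: u}.
Proof. exact: linearZ_LR. Qed.

HB.instance Definition _ :=
  PzRing_isOperatedAlgebra.Build k Omega (bpoly k Omega Z)
    (@scalerA _ _) (@scale1r _ _) (@scalerDr _ _) (fun v a b => scalerDl v a b)
    (@scalerAl _ _) bpoly_scaleAr
    bpoly_operD bpoly_operZ.

End FreeOperatedAlgebra.

Section Evaluation.
Variables (k : comNzRingType) (Omega Y : choiceType) (A : operatedAlgType k Omega).
Variable theta : Y -> A.

Fixpoint eval_letter (x : letter Omega Y) : A :=
  match x with
  | Var y => theta y
  | Brk w s => oper w (foldr (fun z a => eval_letter z * a) 1 s)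
  end.

Definition eval_word (u : bword Omega Y) : A :=
  foldr (fun z a => eval_letter z * a) 1 u.

(* l[theta]: by eval_bvar, eval_morphism and eval_unique this is the unique
   homomorphism of operated algebras extending theta. *)
Definition eval : bpoly k Omega Y -> A := linext eval_word.

Lemma eval_bvar y : eval << bvar Omega y >> = theta y.
Proof. by rewrite /eval linextU /eval_word /= mulr1. Qed.

Lemma eval_morphism : operated_morphism eval.
Proof.
have wordM u v : eval_word (mmul u v) = eval_word u * eval_word v.
  rewrite /eval_word fmM; elim: (u : seq _) => [|x s IH] /=.
    by rewrite mul1r.
  by rewrite IH mulrA.
have evalD : {morph eval : u v / u + v} by exact: linearD.
have evalZ a : {morph eval : u / a *: u} by exact: linearZ_LR.
have eval0 : eval 0 = 0 by exact: linear0.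
have eval_sum := big_morph eval evalD eval0.
have evalU a u : eval << a *g u >> = a *: eval_word u.
  have -> : << a *g u >> = a *: << u >> :> bpoly k Omega Y.
    by apply/malgP=> z; rewrite mcoeffZ !mcoeffU mulrnAr mulr1.
  by rewrite evalZ /eval linextU.
split.
- exact: linextP.
- move=> u v; rewrite malgME eval_sum mulr_suml; apply: eq_bigr => x _.
  rewrite eval_sum mulr_sumr; apply: eq_bigr => y _.
  by rewrite evalU wordM -scalerA oper_scaleAr oper_scaleAl.
- by have := evalU 1 mone; rewrite scale1r /eval_word fm1.
- move=> w u.
  have operD' : {morph (oper w : A -> A) : x y / x + y} by exact: operD.
  have operZ' a (x : A) : oper w (a *: x) = a *: (oper w x : A) by exact: operZ.
  have oper0 : oper w (0 : A) = 0 by have := operZ' 0 0; rewrite !scale0r.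
  transitivity (eval (\sum_(v <- msupp u) u@_v *: << bbrk w v >>)) => //.
  rewrite eval_sum [in RHS]/eval [in RHS]/linext (big_morph _ operD' oper0).
  apply: eq_bigr => v _.
  by rewrite operZ' evalZ evalU scale1r /eval_word /= mulr1.
Qed.

Lemma eval_unique (f : bpoly k Omega Y -> A) :
  operated_morphism f -> (forall y, f << bvar Omega y >> = theta y) -> f =1 eval.
Proof.
case=> lf fM f1 fo fv l; rewrite (linext_unique lf) /eval /linext.
apply: eq_bigr => u _; congr (_ *: _).
have fcons x s : f << FMonom (x :: s) >> = f << FMonom [:: x] >> * f << FMonom s >>.
  rewrite -fM; congr f; rewrite malgM_def fgmulUU mulr1; congr << _ >>.
  by apply/eqP; rewrite fmP fmM.
have f0 : f << FMonom [::] >> = 1.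
  rewrite (_ : FMonom [::] = mone) //; last by apply/eqP; rewrite fmP fm1.
rewrite -[u]fmK; move: (u : seq _) => {u}.
apply: (@seq_letter_ind _ _ (fun x => f << FMonom [:: x] >> = eval_letter x)).
- by move=> y; apply: fv.
- move=> w s IH.
  rewrite [eval_letter _]/= -[foldr _ _ _]/(eval_word (FMonom s)) -IH -fo.
  by rewrite -[oper w _]/(bpoly_oper w _) /bpoly_oper linextU.
- by rewrite f0.
- by move=> x s Hx Hs; rewrite fcons Hx Hs.
Qed.

End Evaluation.

Definition is_Ealgebra (k : comNzRingType) (Omega Y : choiceType)
    (E : bpoly k Omega Y -> Prop) (A : operatedAlgType k Omega) : Prop :=
  forall l, E l -> forall theta : Y -> A, eval theta l = 0.

Fixpoint letter_vars Omega Z (x : letter Omega Z) : seq Z :=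
  match x with
  | Var z => [:: z]
  | Brk _ s => flatten (map (@letter_vars Omega Z) s)
  end.

Fixpoint letter_rename Omega Z Z' (f : Z -> Z') (x : letter Omega Z) :
    letter Omega Z' :=
  match x with
  | Var z => Var Omega (f z)
  | Brk w s => Brk w (map (letter_rename f) s)
  end.

Section Occurrences.
Variable Omega : choiceType.
Implicit Types Y Z : choiceType.

Definition bvars Z (u : bword Omega Z) : seq Z :=
  flatten (map (@letter_vars Omega Z) u).

Definition bdeg Z (z : Z) (u : bword Omega Z) : nat := count_mem z (bvars u).

Definition brename Z Z' (f : Z -> Z') (u : bword Omega Z) : bword Omega Z' :=
  FMonom (map (letter_rename f) u).

(* In words over Y + 'I_n, [inr j] is the j-th placeholder; [fill v q] is
   q[v_0, ..., v_(n-1)]. *)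
Definition fill Y n (v : 'I_n -> Y) (q : bword Omega (Y + 'I_n)%type) :
    bword Omega Y :=
  brename (fun z : Y + 'I_n => match z with inl y => y | inr j => v j end) q.

Definition placeholder_form Y (y : Y) n
    (u : bword Omega Y) (q : bword Omega (Y + 'I_n)%type) : Prop :=
  [/\ bdeg (inl y) q = 0%N, forall j, bdeg (inr j) q = 1%N
    & fill (fun=> y) q = u].

End Occurrences.

Section Polarization.
Local Open Scope mset_scope.
Variables (k : comNzRingType) (Omega Y : choiceType).
Implicit Types (l p : bpoly k Omega Y) (y : Y).

Definition occurs y l : Prop := exists2 u, u \in msupp l & y \in bvars u.

Definition homogeneous y n l : Prop := {in msupp l, forall u, bdeg y u = n}.

(* [p] is P_y(l) for some choice of fresh variables ys_j, that is, distinct and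
   not occurring in l, and of words q_u with q_u[y, ..., y] = u for the
   monomials u of l. *)
Definition is_polarization_in y l p : Prop :=
  exists n (ys : 'I_n -> Y) (q : bword Omega Y -> bword Omega (Y + 'I_n)%type),
    [/\ homogeneous y n l,
        injective ys /\ forall j, ~ occurs (ys j) l,
        {in msupp l, forall u, placeholder_form y u (q u)}
      & p = \sum_(tau : 'S_n) \sum_(u <- msupp l)
              l@_u *: << fill (fun j => ys (tau j)) (q u) >>].

Fixpoint is_polarization_along (s : seq Y) l p : Prop :=
  match s with
  | [::] => p = l
  | y :: s' => exists2 l', is_polarization_in y l l' & is_polarization_along s' l' p
  end.

Definition is_polarization l p : Prop :=
  exists s : seq Y, [/\ uniq s, forall y, y \in s <-> occurs y l
                      & is_polarization_along s l p].

Definition multidegree (u : bword Omega Y) : {mset Y} := seq_mset (bvars u).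

Definition hcomponent (d : {mset Y}) l : bpoly k Omega Y :=
  \sum_(u <- msupp l | multidegree u == d) l@_u *: << u >>.

(* Fresh variables, and the order in which variables are polarized, may be
   chosen independently for each homogeneous component. Such a choice always
   exists: see polarization_choice_exists below. *)
Definition polarization_choice (E : bpoly k Omega Y -> Prop)
    (pol : bpoly k Omega Y -> bpoly k Omega Y) : Prop :=
  forall l, E l -> forall d, is_polarization (hcomponent d l) (pol (hcomponent d l)).

Definition polarization (pol : bpoly k Omega Y -> bpoly k Omega Y)
    (E : bpoly k Omega Y -> Prop) : bpoly k Omega Y -> Prop :=
  span (fun p => exists l d, E l /\ p = pol (hcomponent d l)).

End Polarization.

Section PolarizationExists.
Variables (k : comNzRingType) (Omega Y : choiceType).
Variables (name : nat -> Y) (name_bij : bijective name).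
Implicit Types (l p : bpoly k Omega Y) (y z : Y).

Lemma fresh_exists n (s : seq Y) :
  exists ys : 'I_n -> Y, injective ys /\ forall j, ys j \notin s.
Proof.
case: name_bij => rank nameK rankK; pose N := (\max_(y <- s) rank y).+1.
exists (fun j => name (N + j)); split=> [i j /(can_inj nameK)/addnI/val_inj //|j].
apply/negP=> js; have := @leq_bigmax_seq _ s predT rank _ js isT.
by rewrite nameK leqNgt ltn_addr.
Qed.

Lemma bvars_rename (Z Z' : choiceType) (f : Z -> Z') (u : bword Omega Z) :
  bvars (brename f u) = map f (bvars u).
Proof.
rewrite /bvars /brename /=; move: (u : seq _).
apply: (@seq_letter_ind _ _
  (fun x => letter_vars (letter_rename f x) = map f (letter_vars x))) => //=.
by move=> x s -> ->; rewrite map_cat.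
Qed.

Lemma placeholder_exists y n (u : bword Omega Y) :
  bdeg y u = n -> exists q : bword Omega (Y + 'I_n)%type, placeholder_form y u q.
Proof.
move=> du; pose f (z : Y + 'I_n) := match z with inl z' => z' | inr _ => y end.
have [s [s0 s1 su]] : exists s : seq (letter Omega (Y + 'I_n)%type),
    [/\ count_mem (inl y) (bvars (FMonom s)) = 0%N,
        forall j, count_mem (inr j) (bvars (FMonom s)) = count_mem j (enum 'I_n)
      & map (letter_rename f) s = u].
  have {du}: size (enum 'I_n) = bdeg y u by rewrite size_enum_ord.
  rewrite /bdeg /bvars /=; move: (u : seq _) (enum 'I_n) => {u}.
  apply: (@seq_letter_ind _ _ (fun x => forall t : seq 'I_n,
    size t = count_mem y (letter_vars x) ->
    exists x' : letter Omega (Y + 'I_n)%type,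
    [/\ count_mem (inl y) (letter_vars x') = 0%N,
        forall j, count_mem (inr j) (letter_vars x') = count_mem j t
      & letter_rename f x' = x])) => /=.
  - move=> z t; rewrite addn0; case: eqVneq => [-> | zy].
      case: t => [|j [|]] //= _; exists (Var Omega (inr j)); split=> //= i.
    case: t => //= _; exists (Var Omega (inl z)); split=> //=.
    by rewrite addn0 -[_ == _]/(z == y) (negPf zy).
  - move=> w s IH t /IH[s' [h1 h2 h3]]; exists (Brk w s'); split=> //=.
    by rewrite h3.
  - by case=> // _; exists [::].
  - move=> x s IHx IHs t; rewrite count_cat => st.
    set c := count_mem y _ in st.
    have [|x' [h1 h2 h3]] := IHx (take c t).
      by rewrite size_takel // st leq_addr.
    have [|s' [g1 g2 g3]] := IHs (drop c t).
      by rewrite size_drop st addKn.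
    exists (x' :: s'); split=> /= [|j|]; rewrite ?count_cat ?h1 ?g1 ?h3 ?g3 //.
    by rewrite h2 g2 -count_cat cat_take_drop.
exists (FMonom s); split=> //.
- by move=> j; rewrite /bdeg s1 count_uniq_mem ?enum_uniq // mem_enum.
- by rewrite -[RHS]fmK -su.
Qed.

Lemma polarization_in_exists y n l (s : seq Y) : homogeneous y n l ->
  exists2 p, is_polarization_in y l p &
    forall z m, z \in s -> z != y -> homogeneous z m l -> homogeneous z m p.
Proof.
move=> hl; pose vs := flatten [seq bvars u | u <- msupp l].
have [ys [ys_inj ys_fresh]] := fresh_exists n (vs ++ s).
have [q qP] : exists q : bword Omega Y -> bword Omega (Y + 'I_n)%type,
    {in msupp l, forall u, placeholder_form y u (q u)}.
  apply: (@IndefiniteDescription.functional_choice _ _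
    (fun u q => u \in msupp l -> placeholder_form y u q)) => u.
  have [ul|] := boolP (u \in msupp l); last by exists mone.
  by have [q qP] := placeholder_exists (hl u ul); exists q.
exists (\sum_(tau : 'S_n) \sum_(u <- msupp l)
   l@_u *: << fill (fun j => ys (tau j)) (q u) >>).
  exists n, ys, q; split=> //; split=> // j [u ul ju].
  have /negP[] := ys_fresh j; rewrite mem_cat; apply/orP; left.
  by apply/flatten_mapP; exists u.
move=> z m zs zy hz v; rewrite -mcoeff_neq0 => /eqP vp.
apply/eqP; apply: contra_notT vp => vm.
rewrite raddf_sum big1 // => tau _; rewrite raddf_sum big_seq big1 // => u ul.
rewrite /= mcoeffZ mcoeffU; case: eqP => [e|_]; last by rewrite mulr0n mulr0.
case/eqP: vm; rewrite -e -(hz u ul) /bdeg.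
have [_ _ eu] := qP u ul; rewrite -[in RHS]eu !bvars_rename !count_map.
apply: eq_count => -[z'|j] //=; rewrite [RHS]eq_sym (negPf zy).
by apply/negP=> /eqP ez; have := ys_fresh (tau j); rewrite ez mem_cat zs orbT.
Qed.

Lemma polarization_along_exists (s : seq Y) l : uniq s ->
  (forall z, z \in s -> exists m, homogeneous z m l) ->
  exists p, is_polarization_along s l p.
Proof.
elim: s l => [|y s IH] l /=; first by exists l.
case/andP=> ys us hs; have [n hn] := hs y (mem_head _ _).
have [l' yl' hl'] := polarization_in_exists s hn.
have [//||p sp] := IH l'; last by exists p, l'.
move=> z zs; have [|m hm] := hs z; first by rewrite inE zs orbT.
exists m; apply: hl' => //; by apply: contraNneq ys => <-.
Qed.

Lemma hcomponent_degree d l u : u \in msupp (hcomponent d l) -> multidegree u = d.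
Proof.
rewrite -mcoeff_neq0 => /eqP uc; apply/eqP; apply: contra_notT uc => ud.
rewrite raddf_sum big1 // => v vd; rewrite /= mcoeffZ mcoeffU.
case: eqP => [e|_]; last by rewrite mulr0n mulr0.
by rewrite -e vd in ud.
Qed.

Lemma hcomponent_id d l : {in msupp l, forall u, multidegree u = d} ->
  hcomponent d l = l.
Proof.
move=> ld; rewrite [RHS]monalgE /hcomponent big_seq_cond [RHS]big_seq.
apply: eq_big => [u|u _].
  by case ul: (u \in msupp l) => //=; rewrite (ld u ul) eqxx.
by apply/malgP=> v; rewrite mcoeffZ !mcoeffU mulrnAr mulr1.
Qed.

Lemma polarization_exists d l : exists p, is_polarization (hcomponent d l) p.
Proof.
set c := hcomponent d l; pose s := undup (flatten [seq bvars u | u <- msupp c]).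
have sP y : y \in s <-> occurs y c.
  by rewrite mem_undup; split=> [/flatten_mapP[u]|[u uc uy]];
     [exists u | apply/flatten_mapP; exists u].
have [||p sp] := @polarization_along_exists s c; first exact: undup_uniq.
  by move=> z _; exists (d z) => u /hcomponent_degree <-; rewrite mset_seqE.
by exists p, s; split=> //; apply: undup_uniq.
Qed.

Lemma polarization_choice_exists (E : bpoly k Omega Y -> Prop) :
  exists pol, polarization_choice E pol.
Proof.
pose d (c : bpoly k Omega Y) := multidegree (nth mone (msupp c) 0).
have [pol polP] := @IndefiniteDescription.functional_choice _ _
  (fun c p => is_polarization (hcomponent (d c) c) p)
  (fun c => polarization_exists (d c) c).
exists pol => l _ e; set c := hcomponent e l.
have dc : {in msupp c, forall u, multidegree u = d c}.
  move=> u uc; rewrite (hcomponent_degree uc) /d (hcomponent_degree (d := e) (l := l)) //.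
  apply: mem_nth; apply: leq_ltn_trans (leq0n (index u (msupp c))) _.
  by rewrite index_mem.
by have := polP c; rewrite hcomponent_id.
Qed.

End PolarizationExists.

(* Main.v *)
Require Import Defs.
From HB Require Import structures.
From mathcomp Require Import all_boot all_order all_fingroup all_algebra.
From mathcomp Require Import finmap multiset monalg.

Set Implicit Arguments.
Unset Strict Implicit.
Unset Printing Implicit Defensive.

Import GRing.Theory Num.Theory.
Local Open Scope ring_scope.

(** Say that an element [l] of the free operated algebra vanishes on [A] when
    its value is 0 under all assignments of the variables. The theorem
    compares the vanishing of the elements of [E] with that of the
    polarizations of their homogeneous components, and splits into two facts,
    both using that nonzero integers are invertible in [k].

    An element vanishes iff all its homogeneous components do
    ([vanishes_hcomponent], [vanishes_hcomponents]). Multiplying the value of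
    one variable [y] by a scalar [t] multiplies the value of a word by [t] to
    the power of its degree in [y]; so the values at t = 0, 1, 2, ... are those
    of a polynomial in [t] whose coefficients are the values of the parts of
    fixed degree in [y], and a rational combination of these values isolates
    each part ([vanishes_restrict_degree]). Treating one variable after the
    other isolates the homogeneous components.

    A polarization step from [l] to [p] in a variable [y] preserves and reflects
    vanishing ([vanishes_polarization_in]). Giving all fresh variables of [p]
    the value of [y] turns [p] into [n`!] times [l], so [l] vanishes if [p]
    does. Conversely, substituting the sum of the fresh variables for [y] in
    [l] gives an element that vanishes with [l]. As each placeholder occurs
    once in its word, this element expands into a sum over all maps [f] from
    the placeholders to the fresh variables ([eval_word_placeholder_sum]). Its
    part of degree 1 in every fresh variable collects the bijective [f], that
    is, it is [p] ([polarization_as_restriction]); and passing to such a part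
    preserves vanishing by the first fact. *)

(** * Values of bracket words *)

Section EvalWord.
Variables (k : comNzRingType) (Omega : choiceType) (A : operatedAlgType k Omega).
Implicit Types Y Z : choiceType.

Lemma eq_in_eval_word Y (th1 th2 : Y -> A) (u : bword Omega Y) :
  {in bvars u, th1 =1 th2} -> eval_word th1 u = eval_word th2 u.
Proof.
rewrite /eval_word /bvars; move: (u : seq _) => {u}.
apply: (@seq_letter_ind _ _ (fun x => {in letter_vars x, th1 =1 th2} ->
  eval_letter th1 x = eval_letter th2 x)) => //=.
- by move=> y; apply; rewrite mem_head.
- by move=> w s IH /IH ->.
- move=> x s IHx IHs e; rewrite IHx ?IHs // => z zx; apply: e;
  by rewrite mem_cat zx ?orbT.
Qed.

Lemma eval_word_rename Z Y (f : Z -> Y) (th : Y -> A) (u : bword Omega Z) :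
  eval_word th (brename f u) = eval_word (th \o f) u.
Proof.
rewrite /eval_word /brename /=; move: (u : seq _) => {u}.
apply: (@seq_letter_ind _ _ (fun x =>
  eval_letter th (letter_rename f x) = eval_letter (th \o f) x)) => //=.
- by move=> w s ->.
- by move=> x s -> ->.
Qed.

Lemma eval_word_scale Y (c : Y -> k) (th : Y -> A) (u : bword Omega Y) :
  eval_word (fun y => c y *: th y) u = (\prod_(y <- bvars u) c y) *: eval_word th u.
Proof.
rewrite /eval_word /bvars; move: (u : seq _) => {u}.
apply: (@seq_letter_ind _ _ (fun x => eval_letter (fun y => c y *: th y) x =
  (\prod_(y <- letter_vars x) c y) *: eval_letter th x)) => /=.
- by move=> y; rewrite big_seq1.
- by move=> w s ->; rewrite linearZ.
- by rewrite big_nil scale1r.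
- by move=> x s -> ->; rewrite big_cat /= -scalerA oper_scaleAr oper_scaleAl.
Qed.

Lemma eval_word_scale1 Y (y : Y) (t : k) (th : Y -> A) (u : bword Omega Y) :
  eval_word [eta th with y |-> t *: th y] u = t ^+ bdeg y u *: eval_word th u.
Proof.
transitivity (eval_word (fun z => (if z == y then t else 1) *: th z) u).
  apply: eq_in_eval_word => z _ /=.
  by case: eqP => [->|_]; rewrite ?scale1r.
rewrite eval_word_scale; congr (_ *: _).
by rewrite -big_mkcond big_const_seq iter_mulr_1.
Qed.

(** The value of a word is additive in a variable that occurs in it once:
    products and operators are additive, and in a product exactly one factor
    contains the variable. *)
Lemma eval_word_sum Z (I : finType) (z : Z) (th : Z -> A) (a : I -> A)
    (u : bword Omega Z) : bdeg z u = 1%N ->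
  eval_word [eta th with z |-> \sum_i a i] u =
  \sum_i eval_word [eta th with z |-> a i] u.
Proof.
pose ev s := eval_word th (FMonom s).
have ev0 x s : bdeg z (FMonom s) = 0%N ->
    eval_word [eta th with z |-> x] (FMonom s) = ev s.
  move=> /eqP zs; apply: eq_in_eval_word => y ys /=; case: eqP => // yz.
  by move: zs; rewrite /bdeg -yz -leqn0 leqNgt -has_count has_pred1 ys.
rewrite -[u]fmK; move: (u : seq _) => {u}.
apply: (@seq_letter_ind _ _ (fun x => bdeg z (FMonom [:: x]) = 1%N ->
  eval_letter [eta th with z |-> \sum_i a i] x =
  \sum_i eval_letter [eta th with z |-> a i] x)) => //.
- by move=> y; rewrite /bdeg /=; case: eqP.
- move=> w s IH; rewrite /bdeg /bvars /= cats0 => /IH e.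
  rewrite -[foldr _ _ _]/(eval_word _ (FMonom s)) e linear_sum.
  by apply: eq_bigr.
- move=> x s IHx IHs.
  have -> : bdeg z (FMonom (x :: s)) =
      (count_mem z (letter_vars x) + bdeg z (FMonom s))%N.
    by rewrite /bdeg /bvars /= count_cat.
  have e b : eval_word [eta th with z |-> b] (FMonom (x :: s)) =
    eval_letter [eta th with z |-> b] x * eval_word [eta th with z |-> b] (FMonom s).
    by [].
  have bx : bdeg z (FMonom [:: x]) = count_mem z (letter_vars x).
    by rewrite /bdeg /bvars /= cats0.
  have ex b : eval_letter [eta th with z |-> b] x =
      eval_word [eta th with z |-> b] (FMonom [:: x]).
    by rewrite /eval_word /= mulr1.
  rewrite e (eq_bigr _ (fun i _ => e (a i))).
  move: bx; case: (count_mem z (letter_vars x)) => [|[|//]] bx.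
    rewrite add0n => /IHs ->; rewrite ex (ev0 _ _ bx) mulr_sumr.
    by apply: eq_bigr => i _; rewrite ex (ev0 _ _ bx).
  case=> bs; rewrite (IHx bx) (ev0 _ _ bs) mulr_suml.
  by apply: eq_bigr => i _; rewrite (ev0 _ _ bs).
Qed.

End EvalWord.

(** * Two tools: multiadditive expansion and interpolation *)

(** Expanding all arguments of a multiadditive function yields one term for
    each choice of a summand per argument. *)
Lemma multiadditive_expand (J : finType) (A V : zmodType) (F : (J -> A) -> V)
    (a : J -> A) :
    (forall b c, b =1 c -> F b = F c) ->
    (forall j b, F [eta b with j |-> \sum_i a i] = \sum_i F [eta b with j |-> a i]) ->
  F (fun=> \sum_i a i) = \sum_(f : {ffun J -> J}) F (a \o f).
Proof.
move=> eF addF; set S := \sum_i a i.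
(* Expand the arguments in [s] one by one. The maps that choose the summands
   are kept on all of [J] by making them the identity outside [s]. *)
pose G (s : seq J) b (f : {ffun J -> J}) :=
  F (fun j => if j \in s then a (f j) else b j).
have step s b : uniq s -> F (fun j => if j \in s then S else b j) =
    \sum_(f : {ffun J -> J} | [forall j, (j \notin s) ==> (f j == j)]) G s b f.
  elim: s b => [|j s IH] b.
    move=> _; rewrite (big_pred1 [ffun j => j]) // => f.
    apply/forallP/eqP => [h|->] /=.
      by apply/ffunP=> j; rewrite ffunE; have /eqP := h j.
    by move=> j; rewrite ffunE.
  case/andP=> js us.
  rewrite (eF _ [eta fun k => if k \in s then S else b k with j |-> S]); last first.
    by move=> k /=; rewrite inE; case: eqP.
  (* Maps for [j :: s] that send [j] to [i] correspond to maps for [s], by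
     changing the value at [j] between [i] and [j]. *)
  rewrite addF (partition_big (fun f : {ffun J -> J} => f j) predT) //=.
  apply: eq_bigr => i _.
  rewrite (eF _ (fun k => if k \in s then S else [eta b with j |-> a i] k)); last first.
    by move=> k /=; case: eqP => [->|//]; rewrite (negPf js).
  rewrite IH //.
  pose set_at (i : J) (f : {ffun J -> J}) := [ffun k => if k == j then i else f k].
  rewrite [RHS](reindex_onto (set_at i) (set_at j)) => [|f /andP[_ /eqP fj]].
    apply: eq_big => [f|f hf].
      apply/forallP/andP => [h|[/andP[/forallP h _] /eqP e] k].
        split.
          rewrite ffunE !eqxx andbT; apply/forallP=> k.
          rewrite inE ffunE negb_or; case: eqP => //= _; exact: h.
        apply/eqP/ffunP=> k; rewrite !ffunE; case: eqP => // ->.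
        by have := h j; rewrite js => /eqP.
      have := h k; rewrite inE negb_or ffunE.
      case: eqP => // -> _; rewrite js /=.
      by have := congr1 (fun g : {ffun J -> J} => g j) e; rewrite /= ffunE eqxx => <-.
    apply: eF => k; rewrite inE ffunE /=.
    by case: eqP => [->|//]; rewrite (negPf js).
  by apply/ffunP=> k; rewrite !ffunE; case: eqP => // ->.
have {}step := step (enum J) (fun=> 0) (enum_uniq _).
rewrite (eF _ (fun j => if j \in enum J then S else 0)); last first.
  by move=> j; rewrite mem_enum.
rewrite step; apply: eq_big => [f|f _].
  by apply/forallP=> j; rewrite mem_enum.
by apply: eF => j; rewrite mem_enum.
Qed.

(** Inverting the Vandermonde matrix at the nodes 0, ..., N - 1: the m-th
    coefficient of a polynomial of degree less than N is a fixed rational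
    combination of its values at these nodes. *)
Lemma coef_extraction (N m : nat) :
  exists c : 'I_N -> rat, forall j, (j < N)%N -> \sum_i c i * i%:R ^+ j = (j == m)%:R.
Proof.
pose V := Vandermonde N (\row_(i < N) (i%:R : rat)).
have VU : V \in unitmx.
  rewrite unitmxE det_Vandermonde unitfE; apply/prodf_neq0 => i _.
  apply/prodf_neq0 => j ij; rewrite !mxE subr_eq0 eqr_nat.
  by rewrite eq_sym neq_ltn ij.
pose d := \col_(j < N) ((j == m :> nat)%:R : rat).
exists (fun i => (invmx V *m d) i 0) => j jN.
have := congr1 (fun M : 'cV_N => M (Ordinal jN) 0) (mulKVmx VU d).
rewrite /= mxE [RHS]mxE /= => <-.
by apply: eq_bigr => i _; rewrite mulrC; congr (_ * _); rewrite !mxE.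
Qed.

(** * Restricting an element to a set of monomials *)

Section Restriction.
Variables (k : comNzRingType) (Omega Y : choiceType).
Implicit Types (l : bpoly k Omega Y) (P Q : pred (bword Omega Y)).

Definition restrict P : bpoly k Omega Y -> bpoly k Omega Y :=
  linext (fun u => if P u then << u >> else 0).

HB.instance Definition _ P := GRing.isLinear.Build k _ _ _ (restrict P)
  (linextP (fun u => if P u then << u >> else 0)).

Lemma restrictU P u : restrict P << u >> = if P u then << u >> else 0.
Proof. exact: linextU. Qed.

Lemma linext_restrict (V : lmodType k) (h : bword Omega Y -> V) P l :
  linext h (restrict P l) = \sum_(u <- msupp l | P u) l@_u *: h u.
Proof.
rewrite -[restrict P l]/(\sum_(u <- msupp l) l@_u *: (if P u then << u >> else 0)).
rewrite linear_sum [RHS]big_mkcond; apply: eq_bigr => u _.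
rewrite linearZ /=; case: ifP => _; first by rewrite linextU.
by rewrite linear0 scaler0.
Qed.

Lemma restrictE P l : restrict P l = \sum_(u <- msupp l | P u) l@_u *: << u >>.
Proof.
rewrite [RHS]big_mkcond; apply: eq_bigr => u _.
by case: ifP; rewrite ?scaler0.
Qed.

Lemma scale_malgU (a : k) (u : bword Omega Y) :
  a *: << u >> = << a *g u >> :> bpoly k Omega Y.
Proof. by apply/malgP=> v; rewrite mcoeffZ !mcoeffU mulrnAr mulr1. Qed.

Lemma restrictT l : restrict xpredT l = l.
Proof.
rewrite restrictE [RHS]monalgE; apply: eq_bigr => u _.
by rewrite scale_malgU.
Qed.

Lemma eq_in_restrict P Q l : {in msupp l, P =1 Q} -> restrict P l = restrict Q l.
Proof. by move=> e; apply: eq_big_seq => u /e ->. Qed.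

Lemma restrictI P Q l : restrict P (restrict Q l) = restrict (predI P Q) l.
Proof.
rewrite [LHS]linext_restrict restrictE [LHS]big_mkcond.
rewrite [RHS]big_mkcond; apply: eq_bigr => u _ /=.
by case: (Q u) (P u) => [] []; rewrite ?scaler0.
Qed.

Lemma hcomponentE d l : hcomponent d l = restrict (fun u => multidegree u == d) l.
Proof. by rewrite restrictE. Qed.

End Restriction.

HB.instance Definition _ (k : comNzRingType) (Omega Y : choiceType)
    (A : operatedAlgType k Omega) (th : Y -> A) :=
  GRing.isLinear.Build k _ _ _ (eval th) (linextP (eval_word th)).

Definition vanishes (k : comNzRingType) (Omega Y : choiceType)
    (A : operatedAlgType k Omega) (l : bpoly k Omega Y) : Prop :=
  forall th : Y -> A, eval th l = 0.

(** * Words with placeholders *)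

Section Placeholders.
Variables (k : comNzRingType) (Omega Y : choiceType) (A : operatedAlgType k Omega).
Variable n : nat.
Implicit Types (th : Y -> A) (b : 'I_n -> A) (q : bword Omega (Y + 'I_n)%type).

Definition merge th b (z : Y + 'I_n) : A :=
  match z with inl y => th y | inr j => b j end.

Lemma eval_word_fill th (v : 'I_n -> Y) q :
  eval_word th (fill v q) = eval_word (merge th (th \o v)) q.
Proof. by rewrite eval_word_rename; apply: eq_in_eval_word => -[]. Qed.

Lemma placeholder_form_vars y (u : bword Omega Y) q z :
  placeholder_form y u q -> inl z \in bvars q -> z \in bvars u /\ z != y.
Proof.
case=> q0 _ <- zq; split.
  by rewrite bvars_rename; apply/mapP; exists (inl z).
apply: contra_eq_neq q0 => <-.
by rewrite -lt0n -has_count has_pred1.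
Qed.

Lemma eval_placeholder_form y (u : bword Omega Y) q th x :
  placeholder_form y u q ->
  eval_word (merge th (fun=> x)) q = eval_word [eta th with y |-> x] u.
Proof.
move=> uq; have [_ _ <-] := uq; rewrite eval_word_rename.
apply: eq_in_eval_word => -[z|j] zq /=; last by rewrite eqxx.
by have [_ /negPf ->] := placeholder_form_vars uq zq.
Qed.

Lemma eval_word_placeholder_sum q th (a : 'I_n -> A) :
    (forall j, bdeg (inr j) q = 1%N) ->
  eval_word (merge th (fun=> \sum_i a i)) q =
  \sum_(f : {ffun 'I_n -> 'I_n}) eval_word (merge th (a \o f)) q.
Proof.
move=> q1; apply: (multiadditive_expand (F := fun b => eval_word (merge th b) q)).
  by move=> b c bc; apply: eq_in_eval_word => -[y|j] _ //=.
move=> j b; have e x : eval_word (merge th [eta b with j |-> x]) q =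
    eval_word [eta merge th b with inr j |-> x] q.
  by apply: eq_in_eval_word => -[].
by rewrite e eval_word_sum //; apply: eq_bigr => i _; rewrite e.
Qed.

(** The list of placeholders occurring in [q] is a permutation of ['I_n]. *)
Lemma count_placeholders (P : pred (Y + 'I_n)) q :
    (forall j, bdeg (inr j) q = 1%N) ->
    (forall y, inl y \in bvars q -> ~~ P (inl y)) ->
  count P (bvars q) = #|[pred j | P (inr j)]|.
Proof.
move=> q1 qP; pose right (z : Y + 'I_n) := if z is inr j then Some j else None.
have cE (Q : pred 'I_n) s : count Q (pmap right s) =
    count (fun z => if z is inr j then Q j else false) s.
  by elim: s => //= -[y|j] s IH /=; rewrite IH.
have pe : perm_eq (pmap right (bvars q)) (enum 'I_n).
  apply/allP=> j _; rewrite /= cE count_uniq_mem ?enum_uniq // mem_enum.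
  rewrite -[X in _ == X](q1 j); apply/eqP/eq_count.
  by case.
rewrite cardE size_filter -enumT; have /seq.permP <- := pe; rewrite cE.
by apply: eq_in_count => -[y|j] // /qP /negPf.
Qed.

Lemma bdeg_fill y (u : bword Omega Y) q (ys : 'I_n -> Y) (f : 'I_n -> 'I_n) j :
    placeholder_form y u q -> injective ys -> ys j \notin bvars u ->
  bdeg (ys j) (fill (ys \o f) q) = #|[pred i | f i == j]|.
Proof.
move=> uq ys_inj yu; have [_ q1 _] := uq.
rewrite /bdeg bvars_rename count_map count_placeholders //=.
  by apply: eq_card => i; rewrite !inE (inj_eq ys_inj).
move=> z /(placeholder_form_vars uq)[zu _].
by apply: contraNneq yu => <-.
Qed.

End Placeholders.

Lemma card_fibers1 (T : finType) (f : T -> T) :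
  [forall j, #|[pred i | f i == j]| == 1%N] = injectiveb f.
Proof.
apply/forallP/injectiveP => [f1 i1 i2 e|f_inj j].
  have /card1P[i fi] : #|[pred i | f i == f i2]| == 1%N by [].
  have := fi i1; have := fi i2; rewrite !inE e !eqxx.
  by move=> /esym/eqP -> /esym/eqP.
have [g fK gK] := injF_bij f_inj; apply/card1P; exists (g j) => i.
by rewrite !inE -[in LHS](gK j) (inj_eq f_inj).
Qed.

(** * One polarization step *)

Section Polarized.
Variables (k : comNzRingType) (Omega Y : choiceType) (A : operatedAlgType k Omega).
Implicit Types (l p : bpoly k Omega Y) (th : Y -> A).

(** With the value of [y] given to all the fresh variables, each of the [n`!]
    permutations contributes the value of [l]. *)
Lemma eval_polarization_diag y l p : is_polarization_in y l p ->
  exists n, forall th, exists th', eval th' p = n`!%:R *: eval th l.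
Proof.
case=> n [ys [q [_ [_ ys_fresh] qP ->]]]; exists n => th.
exists (fun z => if z \in codom ys then th y else th z); set th' := fun z => _.
rewrite linear_sum /= (eq_bigr (fun=> eval th l)) => [|tau _].
  by rewrite sumr_const card_Sn scaler_nat.
rewrite linear_sum /= [RHS]/eval [RHS]/linext; apply: eq_big_seq => u ul.
rewrite linearZ /= {1}/eval linextU eval_word_fill; congr (_ *: _).
have uq := qP u ul.
transitivity (eval_word (merge th (fun=> th y)) (q u)).
  apply: eq_in_eval_word => -[z|j] zq /=; rewrite /th'; last by rewrite codom_f.
  case: ifP => // /codomP[j zj].
  have [zu _] := placeholder_form_vars uq zq.
  by case: (ys_fresh j); exists u; rewrite -?zj.
rewrite (eval_placeholder_form _ _ uq).
by apply: eq_in_eval_word => z _ /=; case: eqP => // ->.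
Qed.

(** The witness [l'] is [l] with the sum of the fresh variables substituted for
    [y], expanded over all self-maps [f] of the index set; its terms of degree 1
    in each fresh variable are those with [f] a permutation. *)
Lemma polarization_as_restriction y l p : is_polarization_in y l p ->
  (forall th x, eval [eta th with y |-> x] l = 0) ->
  exists (s : seq Y) l', vanishes A l' /\
    p = restrict (fun u => all (fun z => bdeg z u == 1%N) s) l'.
Proof.
case=> n [ys [q [_ [ys_inj ys_fresh] qP ->]]] l0.
exists [seq ys j | j <- enum 'I_n].
pose term (f : 'I_n -> 'I_n) : bpoly k Omega Y :=
  \sum_(u <- msupp l) l@_u *: << fill (ys \o f) (q u) >>.
exists (\sum_(f : {ffun 'I_n -> 'I_n}) term f); split.
  move=> th; rewrite -[RHS](l0 th (\sum_j th (ys j))) linear_sum /=.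
  under eq_bigr do rewrite linear_sum /=.
  rewrite exchange_big /= [RHS]/eval [RHS]/linext; apply: eq_big_seq => u ul.
  have uq := qP u ul; have [_ q1 _] := uq.
  rewrite -(eval_placeholder_form _ _ uq) eval_word_placeholder_sum // scaler_sumr.
  by apply: eq_bigr => f _; rewrite linearZ /= /eval linextU eval_word_fill.
rewrite linear_sum /=.
transitivity (\sum_(f : {ffun 'I_n -> 'I_n} | injectiveb f) term f).
  rewrite [RHS](reindex (@pval _)) /=; last first.
    pose in_Sn := insubd (1%g : 'S_n).
    by exists in_Sn => /= f Uf; first apply: val_inj; apply: insubdK.
  apply: eq_big => [tau|tau _]; first by rewrite (valP tau).
  by rewrite pvalE.
rewrite [LHS]big_mkcond; apply: eq_bigr => f _; rewrite linear_sum /=.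
rewrite (eq_big_seq (fun u => if injectiveb f then
    l@_u *: << fill (ys \o f) (q u) >> else 0)) => [|u ul].
  by case: ifP => // _; rewrite big1_eq.
rewrite linearZ /= restrictU all_map -card_fibers1.
have -> : all (preim ys (fun z => bdeg z (fill (ys \o f) (q u)) == 1%N)) (enum 'I_n) =
    [forall j, #|[pred i | f i == j]| == 1%N].
  have degE j : bdeg (ys j) (fill (ys \o f) (q u)) = #|[pred i | f i == j]|.
    rewrite (bdeg_fill _ (qP u ul)) //.
    by apply/negP=> ju; apply: (ys_fresh j); exists u.
  by apply/allP/forallP => h j; have := h j; rewrite /= ?mem_enum degE => ->.
by case: ifP; rewrite ?scaler0.
Qed.

End Polarized.

(** * Vanishing over a rational algebra *)

Section CharacteristicZero.
Variables (k : comAlgType rat) (Omega Y : choiceType) (A : operatedAlgType k Omega).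
Implicit Types (l p : bpoly k Omega Y) (th : Y -> A).

(** Scaling [y] by 0, ..., N - 1 and interpolating recovers the part of degree
    [m] in [y], as soon as [N] exceeds the degrees of all monomials of [l]. *)
Lemma vanishes_restrict_degree y m l :
  vanishes A l -> vanishes A (restrict (fun u => bdeg y u == m) l).
Proof.
move=> l0 th; pose N := (\max_(u <- msupp l) bdeg y u).+1.
have [c cP] := coef_extraction N m.
rewrite /eval linext_restrict.
transitivity (\sum_i (c i)%:A *: eval [eta th with y |-> i%:R *: th y] l); last first.
  by rewrite big1 // => i _; rewrite l0 scaler0.
under [RHS]eq_bigr do rewrite /eval /linext scaler_sumr.
rewrite exchange_big big_mkcond /=; apply: eq_big_seq => u ul.
have uN : (bdeg y u < N)%N by rewrite ltnS; apply: leq_bigmax_seq.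
transitivity ((l@_u * (\sum_i c i * i%:R ^+ bdeg y u)%:A) *: eval_word th u).
  by rewrite cP //; case: eqP => _; rewrite ?scale1r ?mulr1 // scale0r mulr0 scale0r.
rewrite -[_%:A]/(in_alg k _) rmorph_sum mulr_sumr scaler_suml.
apply: eq_bigr => i _; rewrite eval_word_scale1 !scalerA; congr (_ *: _).
by rewrite rmorphM rmorphXn rmorph_nat mulrCA mulrA.
Qed.

Lemma vanishes_restrict_degrees (s : seq Y) (d : Y -> nat) l :
  vanishes A l -> vanishes A (restrict (fun u => all (fun y => bdeg y u == d y) s) l).
Proof.
elim: s => [|y s IH] l0 /=.
  by rewrite restrictT.
by rewrite -restrictI; apply/vanishes_restrict_degree/IH.
Qed.

(** On the monomials of [l], the multidegree is [d] as soon as the degrees agree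
    with [d] on the finitely many variables that occur in [l] or in [d]. *)
Lemma vanishes_hcomponent d l : vanishes A l -> vanishes A (hcomponent d l).
Proof.
move=> /(vanishes_restrict_degrees
  ((d : seq Y) ++ flatten [seq bvars u | u <- msupp l]) d).
rewrite hcomponentE (@eq_in_restrict _ _ _ _ (fun u => multidegree u == d)) //.
move=> u ul; apply/allP/eqP => [h|<- y _]; last by rewrite mset_seqE.
apply/msetP=> y; rewrite mset_seqE; apply/eqP.
have [yd|yd] := boolP (y \in d); first by apply: h; rewrite mem_cat yd.
have [yu|yu] := boolP (y \in bvars u).
  by apply: h; rewrite mem_cat; apply/orP; right; apply/flatten_mapP; exists u.
by rewrite (mset_eq0P yd) (count_memPn yu).
Qed.

Lemma vanishes_hcomponents l :
  (forall d, vanishes A (hcomponent d l)) -> vanishes A l.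
Proof.
move=> h th; pose ds := undup [seq multidegree u | u <- msupp l].
transitivity (\sum_(d <- ds) eval th (hcomponent d l)).
  under eq_bigr do rewrite hcomponentE /eval linext_restrict big_mkcond /=.
  rewrite exchange_big /=; apply: eq_big_seq => u ul.
  rewrite -big_mkcond /= (eq_bigl (pred1 (multidegree u))); last first.
    by move=> d; rewrite eq_sym.
  rewrite -big_filter filter_pred1_uniq ?undup_uniq ?big_seq1 // mem_undup.
  exact: map_f.
by rewrite big1 // => d _; apply: h.
Qed.

Lemma vanishes_polarization_in y l p : is_polarization_in y l p ->
  vanishes A p <-> vanishes A l.
Proof.
move=> yp; split=> [p0 th|l0].
  have [n /(_ th)[th' e]] := eval_polarization_diag A yp.
  have : (n`!%:R^-1)%:A *: (n`!%:R *: eval th l) = 0 by rewrite -e p0 scaler0.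
  have -> : n`!%:R = in_alg k n`!%:R by rewrite rmorph_nat.
  rewrite scalerA -[X in X * _]/(in_alg k _) -rmorphM mulVf ?rmorph1 ?scale1r // pnatr_eq0 -lt0n; exact: fact_gt0.
have [s [l' [l'0 ->]]] := polarization_as_restriction yp (fun th x => l0 _).
exact: (vanishes_restrict_degrees s (fun=> 1%N) l'0).
Qed.

Lemma vanishes_polarization l p : is_polarization l p -> vanishes A p <-> vanishes A l.
Proof.
case=> s [_ _]; elim: s l => [|y s IH] l /=; first by move=> ->.
case=> l' yl' /IH e; rewrite e; exact: vanishes_polarization_in yl'.
Qed.

End CharacteristicZero.

Lemma is_Ealgebra_span (k : comNzRingType) (Omega Y : choiceType)
    (S : bpoly k Omega Y -> Prop) (A : operatedAlgType k Omega) :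
  is_Ealgebra (Defs.span S) A <-> is_Ealgebra S A.
Proof.
split=> S0 l Sl; first by apply: S0 => W _; apply.
apply: (Sl (vanishes A)) => //; split=> [th|a u v u0 v0 th]; first exact: linear0.
by rewrite linearP /= u0 v0 scaler0 addr0.
Qed.

Theorem theorem2p14
    (k : comAlgType rat) (Omega Y : choiceType)
    (Y_countably_infinite : exists name : nat -> Y, bijective name)
    (E : bpoly k Omega Y -> Prop) (E_submodule : submodule E)
    (pol : bpoly k Omega Y -> bpoly k Omega Y)
    (pol_choice : polarization_choice E pol)
    (A : operatedAlgType k Omega) :
  is_Ealgebra E A <-> is_Ealgebra (polarization pol E) A.
Proof.
rewrite is_Ealgebra_span; split=> [E0 _ [l [d [El ->]]]|P0 l El].
  apply/(vanishes_polarization A (pol_choice l El d)).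
  by apply: vanishes_hcomponent; apply: E0.
apply: vanishes_hcomponents => d.
apply/(vanishes_polarization A (pol_choice l El d)).
by apply: P0; exists l, d.
Qed.
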